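(* Let $n \geq 2$ and let $I = \{i_1 < \cdots < i_k\} \subset [n-1]$ with $k \geq 1$. Then \[ \sum_J (-1)^d\, \partial_{e_{n-k-d}(x_1, \ldots, x_{n-1})}\, \mathrm{d}_{j_1} \cdots \mathrm{d}_{j_k} \Delta_n = 0, \] where the sum is over all subsets $J = \{j_1 < \cdots < j_k\} \subset [n-1]$ satisfying \[ 1 \leq i_1 \leq j_1 < i_2 \leq j_2 < i_3 \leq j_3 < \cdots < i_k \leq j_k < n, \] and $d = (j_1 - i_1) + \cdots + (j_k - i_k)$.
   Context: Work in $\mathbb{Q}[x_1, \ldots, x_n, \theta_1, \ldots, \theta_n]$ where the $x_i$ commute, the $\theta_i$ anticommute ($\theta_i\theta_j = -\theta_j\theta_i$), and $x_i$ commutes with $\theta_j$. $\Delta_n = \prod_{1 \leq i < j \leq n}(x_j - x_i)$. For a polynomial $g \in \mathbb{Q}[x_1,\ldots,x_n]$, $\partial_g$ is the differential operator obtained by substituting $\partial_{x_i}$ for $x_i$ in $g$. For $i \geq 1$, $\mathrm{d}_i = \sum_{j=1}^n \partial_{x_j}^i \theta_j$, i.e. $\mathrm{d}_i \omega = \sum_j \theta_j \,\partial_{x_j}^i \omega$ (left multiplication by $\theta_j$). $e_r(x_1, \ldots, x_m)$ is the elementary symmetric polynomial of degree $r$, with $e_0 = 1$ and $e_r = 0$ for $r < 0$ or $r > m$. *)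

(* Defs.v *)
From HB Require Import structures.
From mathcomp Require Import all_boot all_order all_algebra.
From mathcomp Require Import mpoly.
Set Implicit Arguments. Unset Strict Implicit. Unset Printing Implicit Defensive.
Import Order.TTheory GRing.Theory Num.Theory.
Local Open Scope ring_scope.

(* Variables x_1..x_n and theta_1..theta_n are indexed by 'I_n (0-based:
   x_{i+1} <-> index i). *)

Notation cpoly n := {mpoly rat[n]}.

(* The superspace ring Q[x_1..x_n, theta_1..theta_n] as a Q[x]-module with basis
   theta_S := theta_{s_1} ... theta_{s_m} (s_1 < ... < s_m), S a subset of 'I_n.
   An element is the function S |-> coefficient of theta_S. *)
Definition superpoly (n : nat) := {ffun {set 'I_n} -> cpoly n}.

Definition sp_const (n : nat) (p : cpoly n) : superpoly n :=
  [ffun S : {set 'I_n} => if S == set0 then p else 0].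

(* Left multiplication by theta_j:
   theta_j (p theta_T) = 0 if j in T, and
   = (-1)^{#{t in T | t < j}} p theta_{T u {j}} otherwise. *)
Definition theta_mul (n : nat) (j : 'I_n) (w : superpoly n) : superpoly n :=
  [ffun S : {set 'I_n} => if j \in S
             then (-1) ^+ #|[set s in S | (val s < val j)%N]| * w (S :\ j)
             else 0].

(* partial_{x_j}^i applied coefficientwise (x_j commutes with the thetas). *)
Definition sp_deriv (n : nat) (j : 'I_n) (i : nat) (w : superpoly n) : superpoly n :=
  [ffun S : {set 'I_n} => iter i (mderiv j) (w S)].

Definition dop (n : nat) (i : nat) (w : superpoly n) : superpoly n :=
  \sum_(j < n) theta_mul j (sp_deriv j i w).

(* partial_g : substitute partial_{x_i} for x_i in g, i.e.
   partial_g = sum_m g_m prod_i partial_{x_i}^{m_i}; applied coefficientwise. *)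
Definition pdiff (n : nat) (g : cpoly n) (p : cpoly n) : cpoly n :=
  \sum_(m <- msupp g) g@_m *: mderivm m p.

Definition sp_pdiff (n : nat) (g : cpoly n) (w : superpoly n) : superpoly n :=
  [ffun S : {set 'I_n} => pdiff g (w S)].

Definition Delta (n : nat) : cpoly n :=
  \prod_(i < n) \prod_(j < n | (i < j)%N) ('X_j - 'X_i).

(* e_r(x_1, ..., x_{n-1}) inside Q[x_1..x_n]; r an integer, e_r = 0 for r < 0
   or r > n-1 (the latter automatically: no such subsets). *)
Definition esym_first (n : nat) (r : int) : cpoly n :=
  match r with
  | Posz r' => \sum_(h : {set 'I_n} | (#|h| == r') && [forall i in h, (val i < n.-1)%N])
                 \prod_(i in h) 'X_i
  | Negz _ => 0
  end.

Definition sorted_elems (n : nat) (A : {set 'I_n}) : seq nat :=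
  sort leq [seq val x | x in A].

Definition dops (n : nat) (J : seq nat) (w : superpoly n) : superpoly n :=
  foldr (fun j acc => dop j acc) w J.

Definition interlaced (k : nat) (I J : seq nat) : bool :=
  [forall l : 'I_k, (nth 0 I l <= nth 0 J l)%N] &&
  [forall l : 'I_k, (l.+1 < k)%N ==> (nth 0 J l < nth 0 I l.+1)%N].

Definition dsum (k : nat) (I J : seq nat) : nat :=
  \sum_(l < k) (nth 0 J l - nth 0 I l)%N.

(* Main.v *)
Require Import Defs.
From HB Require Import structures.
From mathcomp Require Import all_boot all_order all_algebra all_fingroup.
From mathcomp Require Import ssrcomplements mpoly zify.
Set Implicit Arguments. Unset Strict Implicit. Unset Printing Implicit Defensive.
Import Order.TTheory GRing.Theory Num.Theory.
Local Open Scope ring_scope.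

(* Write D_j for d/dx_j, k = #|I|, i_(k+1) = n, and E_(a,b) for the sum of
   D_n^(b-1-j) d_j over a <= j < b.  Symmetric polynomials of positive degree in
   the D_j kill Delta_n, so e_r(D_1, ..., D_(n-1)) acts on it as (-D_n)^r.  Since
   all these operators commute with the d_j, the sum is, up to sign,
     D_n^(i_1) E_(i_1,i_2) E_(i_2,i_3) ... E_(i_k,n) Delta_n.
   The d_j anticommute, hence so do the E_(a,b), and E_(a,b)^2 = 0.  As
   E_(a,n) = D_n^(n-b) E_(a,b) + E_(b,n), the last factor E_(i_k,n) may be replaced
   by E_(i_1,n); finally D_n^(i_1) E_(i_1,n) Delta_n = 0, because D_n^n Delta_n = 0
   and, for s <> n, the complete homogeneous polynomial of degree n - 1 in D_s and
   D_n kills Delta_n. *)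

(** * The Vandermonde determinant and its derivatives *)

Lemma Delta_Vandermonde n :
  Delta n = \det (Vandermonde n (\row_(i < n) ('X_i : cpoly n))).
Proof.
rewrite det_Vandermonde; apply: eq_bigr => i _; apply: eq_bigr => j _.
by rewrite !mxE.
Qed.

(** Permuting the variables permutes the columns of the Vandermonde matrix, hence the sign. *)
Lemma msym_Delta n (s : 'S_n) : msym s (Delta n) = (-1) ^+ s *: Delta n.
Proof.
rewrite Delta_Vandermonde; set V := Vandermonde _ _.
rewrite -(det_map_mx (msym s)).
have -> : map_mx (msym s) V = col_perm s V.
  by apply/matrixP => i j; rewrite !mxE rmorphXn /= /msym mmapX mmap1U.
rewrite col_permE det_mulmx det_perm mulrC odd_permV.
by rewrite mulr_sign scaler_sign.
Qed.

Lemma mcoeff_Delta_perm n (s : 'S_n) (m : 'X_{1..n}) :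
  (Delta n)@_[multinom m (s i) | i < n] = (-1) ^+ s * (Delta n)@_m.
Proof. by rewrite -mcoeff_sym msym_Delta mcoeffZ. Qed.

Lemma mcoeff_Delta_neq0 n (m : 'X_{1..n}) : (Delta n)@_m != 0 ->
  exists s : 'S_n, forall i, m i = s i.
Proof.
(* After transposition the Leibniz term of [s] is, up to sign, the monomial with exponents [s i]
   itself, with no inverse permutation. *)
rewrite Delta_Vandermonde -det_tr /determinant raddf_sum /= => nz.
have [s ms | H] := pickP (fun s : 'S_n => m == [multinom val (s i) | i < n]).
  by exists s => i; rewrite (eqP ms) mnmE.
case/eqP: nz; apply: big1 => s _.
rewrite (eq_bigr (fun i : 'I_n => 'X_i ^+ s i)) => [|i _]; last by rewrite !mxE.
rewrite mprodXnE mulr_sign fun_if mcoeffN mcoeffX.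
suff -> : (\sum_(i < n) U_(i) *+ s i)%MM = [multinom val (s i) | i < n].
  by rewrite eq_sym (H s) oppr0 if_same.
apply/mnmP => j; rewrite mnm_sumE mnmE (bigD1 j) //= mulmnE mnm1E eqxx mul1n.
rewrite big1 ?addn0 // => i ij; by rewrite mulmnE mnm1E (negbTE ij).
Qed.

(* e_r in the variables indexed by A, evaluated at the partial derivatives *)
Definition esymd n (A : {set 'I_n}) r (p : cpoly n) : cpoly n :=
  \sum_(h : {set 'I_n} | (h \subset A) && (#|h| == r)) p^`M[mesym1 h].

(** An elementary symmetric operator in all the derivatives commutes with permutations of the
    variables, so the image of [Delta] is still alternating. *)
Lemma mcoeff_esymd_Delta_perm n r (s : 'S_n) (m : 'X_{1..n}) :
  (esymd [set: 'I_n] r (Delta n))@_[multinom m (s i) | i < n]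
    = (-1) ^+ s * (esymd [set: 'I_n] r (Delta n))@_m.
Proof.
rewrite /esymd !raddf_sum /= mulr_sumr.
rewrite (reindex_inj (h := fun h : {set 'I_n} => s @^-1: h)) /=; last first.
  move=> h1 h2 /setP eqh; apply/setP => i.
  by have := eqh ((s^-1)%g i); rewrite !inE permKV.
apply: eq_big => [h|h _].
  by rewrite !subsetT card_preimset //; apply: perm_inj.
have eqm : ([multinom mesym1 h (s i) | i < n] + [multinom m (s i) | i < n]
             = [multinom (mesym1 h + m)%MM (s i) | i < n])%MM.
  by apply/mnmP => i; rewrite !(mnmE, mnmDE).
have -> : mesym1 (s @^-1: h) = [multinom mesym1 h (s i) | i < n].
  by apply/mnmP => i; rewrite !mnmE inE.
rewrite !mcoeff_mderivm eqm mcoeff_Delta_perm mulrnAr; congr (_ *+ _).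
rewrite [RHS](reindex_inj (h := s)) /=; last exact: perm_inj.
by apply: eq_bigr => i _; rewrite !mnmE.
Qed.

(* The left-hand side is alternating, so a monomial in it has distinct
   exponents; these are at most n - 1, hence are 0, ..., n - 1 in some order,
   whose sum exceeds the degree by r. *)
Lemma esymd_Delta n r : (0 < r)%N -> esymd [set: 'I_n] r (Delta n) = 0.
Proof.
move=> r_gt0; apply/mpolyP => m; rewrite mcoeff0; apply/eqP.
apply: contraT => nz.
have m_inj : injective m.
  move=> i j eqm; apply/eqP; apply: contraT => ij.
  have := mcoeff_esymd_Delta_perm r (tperm i j) m.
  have -> : [multinom m (tperm i j k) | k < n] = m.
    by apply/mnmP => k; rewrite mnmE; case: tpermP => [->|->|].
  rewrite odd_tperm ij expr1 mulN1r => /eqP.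
  by rewrite -addr_eq0 -mulr2n mulrn_eq0 /= (negbTE nz).
have [h card_h [s ms]] : exists2 h : {set 'I_n}, #|h| = r &
    exists s : 'S_n, forall i, (mesym1 h + m)%MM i = s i.
  have [h /andP[/andP[_ /eqP <-] nzh] | H] := pickP
    (fun h : {set 'I_n} => (h \subset [set: 'I_n]) && (#|h| == r) &&
              ((Delta n)@_(mesym1 h + m)%MM != 0)).
    by exists h => //; apply: mcoeff_Delta_neq0.
  case/eqP: nz; rewrite /esymd raddf_sum big1 //= => h Ph.
  rewrite mcoeff_mderivm; have := H h; rewrite Ph /= => /negbFE/eqP ->.
  by rewrite mul0rn.
have m_lt i : (m i < n)%N.
  by apply: leq_ltn_trans (ltn_ord (s i)); rewrite -ms mnmDE leq_addl.
have f_inj : injective (fun i => Ordinal (m_lt i)).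
  by move=> i j /(congr1 val) /= /m_inj.
have : mdeg (mesym1 h + m) = mdeg m.
  rewrite !mdegE (eq_bigr _ (fun i _ => ms i)).
  rewrite -(reindex_inj (P := xpredT) (F := @nat_of_ord n) (@perm_inj _ s)).
  by rewrite (reindex_inj f_inj).
by rewrite mdegD mdeg_mesym1 card_h => /eqP;
  rewrite -{2}[mdeg m]add0n eqn_add2r -leqn0 leqNgt r_gt0.
Qed.

(** * Elementary symmetric operators in a subset of the derivatives *)

Lemma esymd0 n (A : {set 'I_n}) p : esymd A 0 p = p.
Proof.
rewrite /esymd (big_pred1 set0) ?mesym1_set0 ?mderivm0m // => h /=.
by rewrite cards_eq0 andbC; case: eqP => //= ->; rewrite sub0set.
Qed.

(** Operator form of $e_{r+1}(A, x_i) = e_{r+1}(A) + x_i e_r(A)$: the index sets are split according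
    to whether they contain [i]. *)
Lemma esymdU1 n (A : {set 'I_n}) i r p : i \notin A ->
  esymd (i |: A) r.+1 p = esymd A r.+1 p + (esymd A r p)^`M(i).
Proof.
move=> iA; rewrite /esymd raddf_sum (bigID (fun h : {set _} => i \notin h)) /=.
congr (_ + _).
  apply: eq_bigl => h; rewrite andbAC; congr (_ && _).
  apply/andP/idP => [[hs ih]|hs].
    apply/subsetP => x xh; have := subsetP hs x xh; rewrite !inE.
    by case: eqP xh => // -> xh; rewrite xh in ih.
  split; first by apply: subset_trans hs (subsetUr _ _).
  by apply: contra iA; apply: (subsetP hs).
rewrite (reindex_onto (fun h : {set 'I_n} => i |: h) (fun h => h :\ i)) /=; last first.
  by move=> h /andP[_]; rewrite negbK => /setD1K.
have setU1_D1 (h : {set 'I_n}) : ((i |: h) :\ i == h) = (i \notin h).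
  apply/eqP/idP => [<-|]; first by rewrite !inE eqxx.
  exact: setU1K.
apply: eq_big => [h|h].
  rewrite setU11 andbT setU1_D1; case: (boolP (i \in h)) => ih.
    by rewrite andbF; apply/esym/negP => /andP[/subsetP/(_ i ih)]; rewrite (negbTE iA).
  rewrite cardsU1 ih eqSS andbT; congr (_ && _).
  apply/idP/idP => [hs|]; last exact: setUS.
  apply/subsetP => x xh; have := subsetP hs x; rewrite !inE xh orbT => /(_ isT).
  by case: eqP xh => // ->; rewrite (negbTE ih).
rewrite setU1_D1 => /andP[_ ih].
rewrite -mderivmU1m -mderivmDm; congr (_^`M[_]).
apply/mnmP => j; rewrite mnmDE !mnmE !inE eq_sym.
by case: eqP => [<-|_] /=; rewrite ?(negbTE ih) ?addn0.
Qed.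

Lemma esymd_gt n (A : {set 'I_n}) r p : (#|A| < r)%N -> esymd A r p = 0.
Proof.
move=> ltAr; rewrite /esymd big_pred0 // => h; apply/negP => /andP[hA /eqP hr].
by have := subset_leq_card hA; rewrite hr leqNgt ltAr.
Qed.

Lemma mderivmC n (m1 m2 : 'X_{1..n}) (p : cpoly n) :
  p^`M[m1]^`M[m2] = p^`M[m2]^`M[m1].
Proof. by rewrite -!mderivmDm addmC. Qed.

Lemma mderivnD n (i : 'I_n) a b (p : cpoly n) :
  p^`M(i, a + b) = p^`M(i, a)^`M(i, b).
Proof.
by rewrite -mderivmDm; congr (_^`M[_]); apply/mnmP => j; rewrite mnmDE !mulmnE mulnDr.
Qed.

(** * Derivatives of the Vandermonde determinant in the last variable and at most one other *)

Section LastVariable.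
Variable n : nat.
Local Notation N := (@ord_max n).
Local Notation Dl := (Delta n.+1).

(** By [esymd_Delta] the left side of the recurrence [esymdU1] vanishes, so each further degree
    brings a factor $-D_N$. *)
Lemma esymd_last_Delta r : esymd [set~ N] r Dl = (-1) ^+ r *: Dl^`M(N, r).
Proof.
elim: r => [|r ih]; first by rewrite esymd0 scale1r mderivn0.
have := esymdU1 r Dl (A := [set~ N]) (i := N).
rewrite setUCr esymd_Delta // ih !inE eqxx => /(_ isT)/esym/eqP.
by rewrite addr_eq0 mderivZ -mderivnS exprS mulN1r scaleNr => /eqP.
Qed.

(** Only [n] variables remain besides the last one, so $e_r$ in them is zero. *)
Lemma mderiv_last_Delta r : (n < r)%N -> Dl^`M(N, r) = 0.
Proof.
move=> ltnr; have := esymd_last_Delta r; rewrite esymd_gt; last first.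
  by rewrite cardsC1 card_ord.
by move/esym/eqP; rewrite scaler_eq0 signr_eq0 => /eqP.
Qed.

(** On [Delta] the product of all $1 + t D_i$ acts as $1$; leaving out the factors of [s] and [N]
    gives $1/((1 + t D_s)(1 + t D_N))$, whose coefficients are the signed complete homogeneous
    polynomials. The induction on [r] expands this inverse. *)
Lemma esymd_last2_Delta s r : s != N ->
  esymd (~: [set s; N]) r Dl
    = (-1) ^+ r *: \sum_(j < r.+1) Dl^`M(s, j)^`M(N, r - j).
Proof.
move=> sN; elim: r => [|r ih].
  by rewrite esymd0 big_ord1 scale1r !mderivn0.
have := esymdU1 r Dl (A := ~: [set s; N]) (i := s).
have -> : s |: ~: [set s; N] = [set~ N].
  by apply/setP => x; rewrite !inE; case: (eqVneq x s) => [->|].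
rewrite ih !inE eqxx => /(_ isT)/esym/(canRL (addrK _)) ->.
rewrite esymd_last_Delta mderivZ [in RHS]big_ord_recl subn0 mderivn0 scalerDr.
congr (_ + _); rewrite exprS mulN1r scaleNr; congr (- (_ *: _)).
rewrite -mderivmU1m raddf_sum; apply: eq_bigr => j _ /=; rewrite subSS mderivnS.
by rewrite mderivmC mderivmU1m.
Qed.

(** Only [n - 1] variables differ from both [s] and [N], so $e_n$ in them is zero. *)
Lemma mderiv_pair_Delta s : s != N ->
  \sum_(j < n.+1) Dl^`M(s, j)^`M(N, n - j) = 0.
Proof.
move=> sN; have := esymd_last2_Delta n sN; rewrite esymd_gt; last first.
  have : (2 + #|~: [set s; N]| = n.+1)%N.
    by rewrite -[RHS]card_ord -(cardsC [set s; N]) cards2 sN.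
  by move: #|_| => c; lia.
by move/esym/eqP; rewrite scaler_eq0 signr_eq0 => /eqP.
Qed.

(* For s != n the terms with j < i vanish by themselves, and adding them
   completes the sum to a derivative of the one in mderiv_pair_Delta. *)
Lemma mderiv_pair_tail_Delta s i : (0 < i)%N ->
  \sum_(i <= j < n.+1) Dl^`M(s, j)^`M(N, i + (n - j)) = 0.
Proof.
move=> i_gt0; have [->|sN] := eqVneq s N.
  (* When [s] is [N], every term is the derivative of order [n + i] in the last variable. *)
  rewrite big_nat big1 // => j /andP[ij jn].
  rewrite -mderivnD mderiv_last_Delta //.
  by rewrite addnCA subnKC // -[n.+1]add1n leq_add.
have [lni|lin] := ltnP n i; first by rewrite big_geq.
have := congr1 (mderivm (U_(N) *+ i)) (mderiv_pair_Delta sN).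
pose F j := Dl^`M(s, j)^`M(N, n - j)^`M(N, i).
rewrite raddf0 raddf_sum /= -(big_mkord xpredT F) /F {F}.
rewrite (big_cat_nat (n := i)) //=; last exact: leqW.
rewrite [X in X + _]big_nat big1 ?add0r => [H|j /andP[_ ji]].
  by rewrite -[RHS]H; apply: eq_bigr => j _; rewrite -mderivnD addnC.
rewrite -mderivnD mderivmC mderiv_last_Delta ?raddf0 //.
by rewrite addnC; lia.
Qed.
End LastVariable.

(** * Operators on superspace *)

Section Superspace.
Variable n : nat.
Implicit Types (w : superpoly n) (p : cpoly n) (j k : 'I_n).

Lemma theta_mul_is_linear j : linear (theta_mul j).
Proof.
move=> c u v; apply/ffunP => S; rewrite !ffunE.
case: (j \in S); last by rewrite scaler0 addr0.
by rewrite mulrDr -scalerAr.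
Qed.
HB.instance Definition _ j := GRing.isLinear.Build rat (superpoly n)
  (superpoly n) _ (theta_mul j) (theta_mul_is_linear j).

Lemma sp_derivE j i w S : sp_deriv j i w S = (w S)^`M(j, i).
Proof. by rewrite ffunE mderivn_iter. Qed.

Lemma sp_deriv_is_linear j i : linear (sp_deriv j i).
Proof. by move=> c u v; apply/ffunP => S; rewrite !(sp_derivE, ffunE) linearP. Qed.
HB.instance Definition _ j i := GRing.isLinear.Build rat (superpoly n)
  (superpoly n) _ (sp_deriv j i) (sp_deriv_is_linear j i).

Lemma dop_is_linear i : linear (@dop n i).
Proof.
move=> c u v; rewrite /dop scaler_sumr -big_split; apply: eq_bigr => j _.
by rewrite !linearP.
Qed.
HB.instance Definition _ i := GRing.isLinear.Build rat (superpoly n)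
  (superpoly n) _ (@dop n i) (dop_is_linear i).

Lemma sp_deriv0 j w : sp_deriv j 0 w = w.
Proof. by apply/ffunP => S; rewrite sp_derivE mderivn0. Qed.

Lemma sp_derivD j a b w : sp_deriv j a (sp_deriv j b w) = sp_deriv j (a + b) w.
Proof. by apply/ffunP => S; rewrite !sp_derivE addnC mderivnD. Qed.

Lemma sp_derivC j a k b w :
  sp_deriv j a (sp_deriv k b w) = sp_deriv k b (sp_deriv j a w).
Proof. by apply/ffunP => S; rewrite !sp_derivE mderivmC. Qed.

Lemma sp_deriv_theta_mul j i k w :
  sp_deriv j i (theta_mul k w) = theta_mul k (sp_deriv j i w).
Proof.
apply/ffunP => S; rewrite sp_derivE !ffunE -mderivn_iter.
by case: ifP => _; rewrite ?raddf0 // -signr_odd !mulr_sign; case: odd; rewrite ?raddfN.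
Qed.

Lemma theta_mulC j k w : theta_mul j (theta_mul k w) = - theta_mul k (theta_mul j w).
Proof.
wlog ltjk : j k / (j < k)%N => [ih|].
  case: (ltngtP j k) => [|/ih ->|/val_inj ->]; first exact: ih.
    by rewrite opprK.
  by apply/ffunP => S; rewrite !ffunE !inE eqxx /= mulr0 if_same oppr0.
have jk : j != k by rewrite neq_ltn ltjk.
apply/ffunP => S; rewrite !ffunE !inE (eq_sym k j) jk /=.
case: (boolP (j \in S)) => jS; case: (boolP (k \in S)) => kS; rewrite ?mulr0 ?oppr0 //.
rewrite !mulrA -!exprD -mulNr setDDl setUC -setDDl.
congr (_ * _).
(* Only the sign exponents are left to compare. Deleting [k] keeps the elements below [j], while
   deleting [j] removes one element below [k]; this is the minus sign. *)
have -> : [set s in S :\ k | (s < j)%N] = [set s in S | (s < j)%N].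
  apply/setP => s; rewrite !inE; case: eqP => //= ->.
  by rewrite ltnNge (ltnW ltjk) andbF.
have -> : [set s in S | (s < k)%N] = j |: [set s in S :\ j | (s < k)%N].
  by apply/setP => s; rewrite !inE; case: eqP => //= ->; rewrite jS.
by rewrite cardsU1 !inE eqxx /= add1n addSn exprS mulN1r opprK addnC.
Qed.

Lemma sp_deriv_dop j i a w : sp_deriv j i (dop a w) = dop a (sp_deriv j i w).
Proof.
rewrite /dop raddf_sum; apply: eq_bigr => k _ /=.
by rewrite sp_deriv_theta_mul sp_derivC.
Qed.

Lemma dopC a b w : dop a (dop b w) = - dop b (dop a w).
Proof.
have dop2 c d : dop c (dop d w) =
    \sum_j \sum_k theta_mul j (theta_mul k (sp_deriv j c (sp_deriv k d w))).
  rewrite {1}/dop; apply: eq_bigr => j _; rewrite sp_deriv_dop.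
  rewrite /dop raddf_sum; apply: eq_bigr => k _ /=.
  by rewrite (sp_derivC k).
rewrite !dop2 exchange_big -sumrN; apply: eq_bigr => k _.
by rewrite -sumrN; apply: eq_bigr => j _; rewrite theta_mulC sp_derivC.
Qed.

Lemma pdiff_is_linear (g : cpoly n) : linear (pdiff g).
Proof.
move=> c p q; rewrite /pdiff scaler_sumr -big_split; apply: eq_bigr => m _.
by rewrite linearP /= scalerDr !scalerA mulrC.
Qed.
HB.instance Definition _ g := GRing.isLinear.Build rat {mpoly rat[n]}
  {mpoly rat[n]} _ (pdiff g) (pdiff_is_linear g).

Lemma sp_pdiff_theta_mul g k w : sp_pdiff g (theta_mul k w) = theta_mul k (sp_pdiff g w).
Proof.
apply/ffunP => S; rewrite !ffunE.
by case: ifP => _; rewrite ?raddf0 // -signr_odd !mulr_sign; case: odd; rewrite ?raddfN.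
Qed.

Lemma sp_pdiff_is_linear g : linear (@sp_pdiff n g).
Proof. by move=> c u v; apply/ffunP => S; rewrite !ffunE linearP. Qed.
HB.instance Definition _ g := GRing.isLinear.Build rat (superpoly n)
  (superpoly n) _ (@sp_pdiff n g) (sp_pdiff_is_linear g).

Lemma sp_pdiff_dop g a w : sp_pdiff g (dop a w) = dop a (sp_pdiff g w).
Proof.
rewrite /dop raddf_sum; apply: eq_bigr => j _ /=; rewrite sp_pdiff_theta_mul.
congr (theta_mul j _); apply/ffunP => S; rewrite !(sp_derivE, ffunE).
rewrite /pdiff raddf_sum; apply: eq_bigr => m _ /=.
by rewrite mderivmZ mderivmC.
Qed.

Lemma sp_pdiff_dops g J w : sp_pdiff g (dops J w) = dops J (sp_pdiff g w).
Proof. by elim: J => //= j J <-; rewrite sp_pdiff_dop. Qed.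

Lemma sp_pdiff_const g p : sp_pdiff g (sp_const p) = sp_const (pdiff g p).
Proof. by apply/ffunP => S; rewrite !ffunE; case: eqP; rewrite ?raddf0. Qed.

Lemma sp_deriv_const j i p : sp_deriv j i (sp_const p) = sp_const (p^`M(j, i)).
Proof. by apply/ffunP => S; rewrite sp_derivE !ffunE; case: eqP; rewrite ?raddf0. Qed.

Lemma sp_const_is_linear : linear (@sp_const n).
Proof.
move=> c p q; apply/ffunP => S; rewrite !ffunE.
by case: eqP; rewrite ?scaler0 ?addr0.
Qed.
HB.instance Definition _ := GRing.isLinear.Build rat {mpoly rat[n]}
  (superpoly n) _ (@sp_const n) sp_const_is_linear.

(** [pdiff] sums over the support of its symbol, which is hard to describe for a sum. Enlarging the
    range to all monomials of bounded degree allows an exchange of sums. *)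
Lemma pdiff_sumX (I : finType) (P : pred I) (F : I -> 'X_{1..n}) p :
  pdiff (\sum_(i | P i) 'X_[F i]) p = \sum_(i | P i) p^`M[F i].
Proof.
pose K := \max_i (mdeg (F i)).+1.
set g := \sum_(i | _) _.
have coefg m : g@_m = \sum_(i | P i) (F i == m)%:R.
  by rewrite raddf_sum; apply: eq_bigr => i _ /=; rewrite mcoeffX.
have -> : pdiff g p = \sum_(m : 'X_{1..n < maxn K (msize g)}) g@_m *: p^`M[m].
  pose T : subFinType _ := 'X_{1..n < maxn K (msize g)}.
  rewrite /pdiff (big_mksub T) /=; first last.
  - by move=> x /msize_mdeg_lt /leq_trans -> //; rewrite leq_maxr.
  - by rewrite msupp_uniq.
  by rewrite big_rmcond //= => m /memN_msupp_eq0 ->; rewrite scale0r.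
under eq_bigr do rewrite coefg scaler_suml.
rewrite exchange_big; apply: eq_bigr => i _ /=.
have ltK : (mdeg (F i) < maxn K (msize g))%N.
  by rewrite leq_max; apply/orP; left; apply: (leq_bigmax i).
rewrite (bigD1 (BMultinom ltK)) //= eqxx scale1r big1 ?addr0 // => m.
rewrite -val_eqE /= eq_sym => /negbTE ->; exact: scale0r.
Qed.
End Superspace.

(** The symbol is $e_r$ in all variables but [ord_max], so [esymd_last_Delta] turns it into a power
    of the last derivative. *)
Lemma sp_pdiff_esym_first n r :
  sp_pdiff (esym_first n.+1 r%:Z) (sp_const (Delta n.+1))
    = (-1) ^+ r *: sp_deriv ord_max r (sp_const (Delta n.+1)).
Proof.
rewrite sp_pdiff_const sp_deriv_const -linearZ -esymd_last_Delta /=.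
congr sp_const.
transitivity (pdiff (\sum_(h : {set 'I_n.+1} |
    (h \subset [set~ ord_max]) && (#|h| == r)) 'X_[mesym1 h]) (Delta n.+1));
  last exact: pdiff_sumX.
congr pdiff; apply: eq_big => [h|h _].
  rewrite andbC; congr (_ && _); apply/forall_inP/subsetP => H x /H; rewrite !inE.
    by rewrite -val_eqE /= neq_ltn => ->.
  by rewrite -val_eqE /= neq_ltn [(n < x)%N]ltnNge leq_ord orbF.
rewrite mprodXE; congr 'X_[_]; apply/mnmP => i; rewrite mnm_sumE mnmE.
case: (boolP (i \in h)) => ih.
  rewrite (bigD1 i) //= mnm1E eqxx big1 // => j /andP[_ ij].
  by rewrite mnm1E (negbTE ij).
by rewrite big1 // => j jh; rewrite mnm1E; case: eqP jh ih => // -> ->.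
Qed.

(** Collecting the terms by the index [s] of the theta factor reduces this to
    [mderiv_pair_tail_Delta] for each [s]. *)
Lemma dop_tail_Delta n i : (0 < i)%N ->
  \sum_(i <= j < n.+1)
     sp_deriv ord_max (i + (n - j)) (dop j (sp_const (Delta n.+1))) = 0.
Proof.
move=> i_gt0.
under eq_bigr do rewrite sp_deriv_dop sp_deriv_const.
rewrite /dop exchange_big big1 //= => s _.
under eq_bigr do rewrite sp_deriv_const mderivmC.
by rewrite -!raddf_sum mderiv_pair_tail_Delta // !raddf0.
Qed.

(** * Products of anticommuting blocks *)

(* The sequences J with i_l <= j_l < i_(l+1), where n plays the role of i_(k+1):
   this is what the default value of head is for. *)
Fixpoint interlacings n (I : seq nat) : seq (seq nat) :=
  if I is i :: I' then
    [seq j :: J | j <- index_iota i (head n I'), J <- interlacings n I']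
  else [:: [::]].

(* The sum of the i_(l+1) - 1 - j_l, so that n - k - d = i_1 + gaps. *)
Fixpoint gaps n (I J : seq nat) : nat :=
  match I, J with
  | i :: I', j :: J' => (head n I').-1 - j + gaps n I' J'
  | _, _ => 0
  end.

Lemma interlacings_uniq n I : uniq (interlacings n I).
Proof.
elim: I => //= i I ih; apply: allpairs_uniq_dep; rewrite ?iota_uniq //.
by move=> [j J] [j' J'] _ _ /= [-> ->].
Qed.

(** The default value [n] of the outer [nth] bounds the last entry of [J]. *)
Lemma mem_interlacings n I J :
  J \in interlacings n I =
    (size J == size I) &&
    all (fun l => nth 0 I l <= nth 0 J l < nth n I l.+1)%N (iota 0 (size I)).
Proof.
elim: I J => [|i I ih] [|j J] //=.
  by apply/negP => /allpairsPdep[x [y [_ _]]].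
rewrite eqSS nth0 -(addn0 1%N) iotaDl all_map.
apply/allpairsPdep/and3P => [[x [y [xi yJ [-> ->]]]]|[sJ hj aJ]].
  by move: xi yJ; rewrite ih mem_index_iota => -> /andP[-> ->].
by exists j, J; rewrite mem_index_iota ih hj sJ.
Qed.

(** Telescoping: $i_{l+1} - i_l$ is the sum of $i_{l+1} - 1 - j_l$, $j_l - i_l$ and $1$. *)
Lemma gaps_dsum n I J : J \in interlacings n I ->
  (head n I + gaps n I J + dsum (size I) I J + size I = n)%N.
Proof.
elim: I J => [|i I ih] [|j J] //=; rewrite ?inE //.
- by rewrite /dsum big_ord0 => _; lia.
- by move=> /allpairsPdep[x [y [_ _]]].
move=> /allpairsPdep[x [y [xi yJ [-> ->]]]].
move: xi (ih _ yJ); rewrite mem_index_iota /dsum big_ord_recl /=.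
move: (\sum_(l < _) _)%N => d; lia.
Qed.

Section Chain.
(** [N a] stands for the power $D_n^a$ of the last derivative and [D j] for $d_j$; only their
    commutation rules enter below. *)
Variables (V : lmodType rat) (N D : nat -> {linear V -> V}).
Hypothesis N0 : forall v, N 0 v = v.
Hypothesis ND : forall a b v, N a (N b v) = N (a + b) v.
Hypothesis NDC : forall a j v, N a (D j v) = D j (N a v).
Hypothesis DC : forall i j v, D i (D j v) = - D j (D i v).

(** The operator $E_{a,b}$. *)
Definition block a b v := \sum_(a <= j < b) N (b.-1 - j) (D j v).

Fixpoint chain i (I : seq nat) v :=
  if I is i' :: I' then block i i' (chain i' I' v) else v.

Lemma NC a b v : N a (N b v) = N b (N a v).
Proof. by rewrite !ND addnC. Qed.

Lemma block_is_linear a b : linear (block a b).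
Proof.
move=> c u v; rewrite /block scaler_sumr -big_split; apply: eq_bigr => j _.
by rewrite !linearP.
Qed.
HB.instance Definition _ a b := GRing.isLinear.Build rat V V _ (block a b)
  (block_is_linear a b).

Lemma N_block c a b v : N c (block a b v) = block a b (N c v).
Proof.
rewrite /block raddf_sum; apply: eq_bigr => j _ /=.
by rewrite NC NDC.
Qed.

Lemma blockC a b c d v : block a b (block c d v) = - block c d (block a b v).
Proof.
have block2 x y z t : block x y (block z t v) = \sum_(x <= j < y)
    \sum_(z <= k < t) N (y.-1 - j) (N (t.-1 - k) (D j (D k v))).
  rewrite {1}/block; apply: eq_bigr => j _; rewrite /block !raddf_sum.
  by apply: eq_bigr => k _ /=; rewrite -NDC.
rewrite !block2 exchange_big -sumrN; apply: eq_bigr => k _.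
by rewrite -sumrN; apply: eq_bigr => j _; rewrite NC DC !raddfN.
Qed.

(** Anticommuting with itself gives $2 E_{a,b}^2 = 0$, and $2$ is invertible in [rat]. *)
Lemma block_sq a b v : block a b (block a b v) = 0.
Proof.
have /eqP := blockC a b a b v; rewrite -addr_eq0 -mulr2n -scaler_nat.
by rewrite scaler_eq0 pnatr_eq0 => /eqP.
Qed.

Lemma block_cat i a b v : (i <= a <= b)%N ->
  block i b v = N (b - a) (block i a v) + block a b v.
Proof.
move=> /andP[ia ab]; rewrite {1}/block (big_cat_nat (n := a)) //=; congr (_ + _).
rewrite raddf_sum big_nat [RHS]big_nat; apply: eq_bigr => j /andP[_ ja] /=.
by rewrite ND; congr (N _ _); lia.
Qed.

Lemma chain_is_linear i I : linear (chain i I).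
Proof. by elim: I i => //= i' I ih i c u v; rewrite ih linearP. Qed.
HB.instance Definition _ i I := GRing.isLinear.Build rat V V _ (chain i I)
  (chain_is_linear i I).

Lemma N_chain c i I v : N c (chain i I v) = chain i I (N c v).
Proof. by elim: I i => //= i' I ih i; rewrite N_block ih. Qed.

Lemma block_chain a b i I v :
  block a b (chain i I v) = (-1) ^+ size I *: chain i I (block a b v).
Proof.
elim: I i => [|i' I ih] i /=; first by rewrite scale1r.
by rewrite blockC ih linearZ exprS mulN1r scaleNr.
Qed.

(* The block [i, b) differs from [last i I, b) by multiples of the blocks
   already present in the chain, and blocks square to zero. *)
Lemma chain_block_last b i I v : path leq i I -> (last i I <= b)%N ->
  chain i I (block (last i I) b v) = chain i I (block i b v).
Proof.
elim: I i => //= i' I ih i /andP[ii' pI] lb; rewrite ih //.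
have i'b : (i' <= b)%N.
  apply: leq_trans lb; move: pI; rewrite path_sortedE; last exact: leq_trans.
  have := mem_last i' I; rewrite inE => /predU1P[-> //|li /andP[/allP/(_ _ li)]].
  by [].
rewrite (@block_cat i i' b) ?ii' // !linearD /= N_block.
(* In the extra term the outer block moves across the chain to its own copy, and the square
   vanishes. *)
by rewrite [X in _ = X + _]block_chain block_sq linear0 scaler0 add0r.
Qed.

Definition dseq (J : seq nat) v := foldr (fun j acc => D j acc) v J.

Fixpoint blocks n (I : seq nat) v :=
  if I is i :: I' then block i (head n I') (blocks n I' v) else v.

(** Expanding the product picks one [j] from each block, which is an interlacing sequence; the
    exponents of the [N] factors add up to [gaps]. *)
Lemma blocks_sum n I v :
  blocks n I v = \sum_(J <- interlacings n I) N (gaps n I J) (dseq J v).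
Proof.
elim: I => [|i I ih] /=; first by rewrite big_seq1 N0.
rewrite big_allpairs_dep; apply: eq_bigr => j _.
rewrite ih !raddf_sum; apply: eq_bigr => J _ /=.
by rewrite -NDC ND.
Qed.

Lemma blocks_chain n i I v :
  blocks n (i :: I) v = chain i I (block (last i I) n v).
Proof. by elim: I i => //= i' I ih i; rewrite -ih. Qed.

Lemma interlacing_sum_eq0 n i I v : sorted leq (i :: I) -> (last i I <= n)%N ->
  \sum_(i <= j < n) N (i + (n.-1 - j)) (D j v) = 0 ->
  \sum_(J <- interlacings n (i :: I)) N (i + gaps n (i :: I) J) (dseq J v) = 0.
Proof.
move=> sI lI tail0.
under eq_bigr do rewrite -ND.
rewrite -raddf_sum -blocks_sum blocks_chain /= chain_block_last // N_chain.
(* The last block now starts at [i], so [N i] applied to it is exactly the sum in [tail0]. *)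
rewrite (_ : N i _ = 0) ?linear0 // -[RHS]tail0 raddf_sum.
by apply: eq_bigr => j _ /=; rewrite ND.
Qed.
End Chain.

(** * Interlacing subsets *)

Lemma mem_sorted_elems n (A : {set 'I_n}) (i : 'I_n) :
  (val i \in sorted_elems A) = (i \in A).
Proof. by rewrite mem_sort mem_map ?mem_enum //; apply: val_inj. Qed.

Lemma size_sorted_elems n (A : {set 'I_n}) : size (sorted_elems A) = #|A|.
Proof. by rewrite size_sort size_map cardE. Qed.

Lemma sorted_elems_uniq n (A : {set 'I_n}) : uniq (sorted_elems A).
Proof. by rewrite sort_uniq map_inj_uniq ?enum_uniq //; apply: val_inj. Qed.

Lemma sorted_elems_sorted n (A : {set 'I_n}) : sorted leq (sorted_elems A).
Proof. exact: (sort_sorted leq_total). Qed.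

Lemma sorted_elems_lt n (A : {set 'I_n}) x : x \in sorted_elems A -> (x < n)%N.
Proof. by rewrite mem_sort => /mapP[i _ ->]; apply: ltn_ord. Qed.

Lemma sorted_elems_inj n : injective (@sorted_elems n).
Proof. by move=> A B eqAB; apply/setP => i; rewrite -!mem_sorted_elems eqAB. Qed.

Lemma sorted_elems_surj n (s : seq nat) : sorted ltn s -> {in s, forall x, x < n}%N ->
  s = sorted_elems [set i : 'I_n | val i \in s].
Proof.
move=> ss s_lt.
apply: (irr_sorted_eq ltn_trans ltnn) => //.
  by rewrite ltn_sorted_uniq_leq sorted_elems_uniq sorted_elems_sorted.
move=> x; apply/idP/idP => [xs|].
  by rewrite -[x]/(val (Ordinal (s_lt x xs))) mem_sorted_elems inE.
move=> xS; have lx := sorted_elems_lt xS.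
by move: xS; rewrite -[x]/(val (Ordinal lx)) mem_sorted_elems inE.
Qed.

(** [interlaced] compares neighbours only; the bound of the last entry by [n] comes from the
    hypothesis on [J]. *)
Lemma mem_interlacings_interlaced n (I J : seq nat) :
  size J = size I -> {in J, forall x, x < n}%N ->
  (J \in interlacings n I) = interlaced (size I) I J.
Proof.
move=> sJ J_lt.
have nthI l : (l < size I)%N -> nth n I l = nth 0%N I l.
  by move=> lI; apply: set_nth_default.
rewrite mem_interlacings sJ eqxx /= /interlaced.
apply/allP/andP => [H|[/forallP H1 /forallP H2] l].
  split; apply/forallP => l; have := H l;
    rewrite mem_iota /= ltn_ord => /(_ isT)/andP[] //.
  move=> _ lt; apply/implyP => lI.
  by rewrite -nthI.
rewrite mem_iota /= add0n => lI; have /= -> := H1 (Ordinal lI).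
have := H2 (Ordinal lI); case: ltnP => /= [lS lt|lS].
  by rewrite nthI.
by move=> _; rewrite [nth n I _]nth_default //; apply/J_lt/mem_nth; rewrite sJ.
Qed.

(** The chain $j_l < i_{l+1} \le j_{l+1}$ makes [J] strictly increasing, so that it lists a subset
    of $[n-1]$. *)
Lemma interlacings_ltn_sorted n I J :
  {in I, forall x, x < n}%N -> 0%N \notin I -> J \in interlacings n I ->
  [/\ sorted ltn J, {in J, forall x, x < n}%N, 0%N \notin J & size J = size I].
Proof.
move=> I_lt I0; rewrite mem_interlacings => /andP[/eqP sJ /allP HJ].
have IJ l : (l < size I)%N -> (nth 0 I l <= nth 0 J l < nth n I l.+1)%N.
  by move=> lI; apply: HJ; rewrite mem_iota.
split=> //.
- apply/(sortedP 0) => l; rewrite sJ => lI.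
  have /andP[_] := IJ l (ltnW lI).
  rewrite (@set_nth_default _ I 0%N n) // => /leq_trans; apply.
  by have /andP[] := IJ _ lI.
- move=> _ /(nthP 0)[l lJ <-]; rewrite sJ in lJ.
  have /andP[_ /leq_trans] := IJ l lJ; apply.
  have [lI|lI] := ltnP l.+1 (size I); last by rewrite nth_default.
  exact/ltnW/I_lt/mem_nth.
- apply/negP => /(nthP 0)[l lJ Jl0]; rewrite sJ in lJ.
  have := IJ l lJ; rewrite Jl0 leqn0 => /andP[/eqP Il0 _].
  by case/negP: I0; rewrite -Il0 mem_nth.
Qed.

(** [sorted_elems] is a bijection from the admissible subsets onto [interlacings]. *)
Lemma sum_interlaced n (V : zmodType) (I : {set 'I_n}) (F : seq nat -> V) :
  0%N \notin sorted_elems I ->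
  \sum_(J : {set 'I_n} | [&& #|J| == #|I|, 0%N \notin [seq val x | x in J] &
     interlaced #|I| (sorted_elems I) (sorted_elems J)]) F (sorted_elems J)
  = \sum_(J <- interlacings n (sorted_elems I)) F J.
Proof.
move=> I0; rewrite -big_filter.
rewrite -(big_map (@sorted_elems n) xpredT F).
apply: perm_big; apply: uniq_perm.
- rewrite map_inj_uniq; last exact: sorted_elems_inj.
  exact/filter_uniq/index_enum_uniq.
- exact: interlacings_uniq.
have mem0 (J : {set 'I_n}) : (0%N \in [seq val x | x in J]) = (0%N \in sorted_elems J).
  by rewrite mem_sort.
have mem_int (J : {set 'I_n}) : #|J| = #|I| ->
    (sorted_elems J \in interlacings n (sorted_elems I)) =
    interlaced #|I| (sorted_elems I) (sorted_elems J).
  move=> cJ; rewrite -(size_sorted_elems I); apply: mem_interlacings_interlaced.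
  - by rewrite !size_sorted_elems.
  - exact: sorted_elems_lt.
move=> s; apply/mapP/idP => [[J]|sI].
  rewrite mem_filter => /andP[/and3P[/eqP cJ _ IJ] _] ->.
  by rewrite mem_int.
have [ss s_lt s0 size_s] := interlacings_ltn_sorted (@sorted_elems_lt n I) I0 sI.
have eqs := sorted_elems_surj ss s_lt.
exists [set i : 'I_n | val i \in s] => //.
rewrite mem_filter mem_index_enum andbT mem0 -eqs s0 /=.
have cs : #|[set i : 'I_n | val i \in s]| = #|I|.
  by rewrite -!size_sorted_elems -eqs.
by rewrite cs eqxx [X in interlaced _ _ X]eqs -mem_int // -eqs.
Qed.

(* Subsets of [n-1] = {1,...,n-1} are subsets of 'I_n not containing 0. *)
Theorem theorem1p9 (n : nat) (I : {set 'I_n}) :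
  (2 <= n)%N ->
  (0%N \notin [seq val x | x in I]) ->
  (1 <= #|I|)%N ->
  \sum_(J : {set 'I_n} | [&& #|J| == #|I|,
                            0%N \notin [seq val x | x in J] &
                            interlaced #|I| (sorted_elems I) (sorted_elems J)])
     (-1) ^+ dsum #|I| (sorted_elems I) (sorted_elems J) *:
       sp_pdiff (esym_first n (n%:Z - #|I|%:Z - (dsum #|I| (sorted_elems I) (sorted_elems J))%:Z))
         (dops (sorted_elems J) (sp_const (Delta n)))
  = 0 :> superpoly n.
Proof.
move=> _; rewrite -(mem_sort leq) -/(sorted_elems I) => I0 I_gt0.
pose F J := (-1) ^+ dsum #|I| (sorted_elems I) J *:
  sp_pdiff (esym_first n (n%:Z - #|I|%:Z - (dsum #|I| (sorted_elems I) J)%:Z))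
           (dops J (sp_const (Delta n))).
rewrite (sum_interlaced F) // /F {F}.
(* A successor is required for [ord_max]; the value zero contradicts the nonemptiness of [I]. *)
move: I I0 I_gt0; case: n => [|n] I.
  by move=> _; rewrite leqNgt (leq_ltn_trans (max_card _)) ?card_ord.
rewrite -size_sorted_elems.
move: (sorted_elems_sorted I) (@sorted_elems_lt _ I).
case: (sorted_elems I) => [//|i s]; set I' := (i :: s) => sI ltI I0 _.
have i_gt0 : (0 < i)%N by move: I0; rewrite inE eq_sym lt0n negb_or => /andP[].
pose N a : {linear superpoly n.+1 -> superpoly n.+1} := sp_deriv ord_max a.
pose D j : {linear superpoly n.+1 -> superpoly n.+1} := @dop n.+1 j.
have key := @interlacing_sum_eq0 (superpoly n.+1) N D (@sp_deriv0 _ _) (@sp_derivD _ _)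
  (fun a j v => @sp_deriv_dop n.+1 ord_max a j v) (@dopC n.+1)
  n.+1 i s (sp_const (Delta n.+1)) sI (ltnW (ltI _ (mem_last _ _)))
  (dop_tail_Delta n i_gt0).
(* The sign $(-1)^d$ and the sign $(-1)^{n-k-d}$ from [sp_pdiff_esym_first] multiply to
   $(-1)^{n-k}$, the same for all [J]. *)
have /(etrans _) := congr1 ( *:%R ((-1) ^+ (n.+1 - size I'))) key.
rewrite scaler0; apply; rewrite scaler_sumr.
rewrite big_seq [RHS]big_seq; apply: eq_bigr => J Jin.
have eqn : (i + gaps n.+1 I' J + dsum (size I') I' J + size I' = n.+1)%N.
  exact: gaps_dsum Jin.
rewrite sp_pdiff_dops.
(* The degree is thus a natural number, which selects the [Posz] branch of [esym_first]. *)
have -> : n.+1%:Z - (size I')%:Z - (dsum (size I') I' J)%:Z = (i + gaps n.+1 I' J)%N%:Z.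
  by clear -eqn; lia.
rewrite sp_pdiff_esym_first.
have dopsZ c w : dops J (c *: w) = c *: dops J w :> superpoly n.+1.
  by elim: (J) => //= j J' ->; rewrite linearZ.
have dops_deriv a w : dops J (sp_deriv ord_max a w) = sp_deriv ord_max a (dops J w).
  by elim: (J) => //= j J' ->; rewrite sp_deriv_dop.
rewrite dopsZ dops_deriv scalerA -exprD; congr (_ ^+ _ *: _).
by clear -eqn; lia.
Qed.
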